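(* Let $\gamma,\rho\in\mathfrak{M}^1$ with $\|\gamma\|_{\mathcal{S}^2}=1$ and $\rho\ne 0$, and let $\Omega\subset\mathbb{R}^{2d}$ be measurable. If $\mathcal{K}:\mathbb{R}^{2d}\times\mathbb{R}^{2d}\to\mathcal{B}(L^2(\mathbb{R}^d))$ is such that $$I_{\mathcal{K}}(\mathfrak{V}_\gamma\rho):=\int_{\mathbb{R}^{2d}}\mathcal{K}(\,\cdot\,,w)\,\mathfrak{V}_\gamma\rho(w)\,dw$$ is bounded and boundedly invertible on $\mathfrak{V}_\gamma(\mathfrak{M}^1)\subset L^1(\mathbb{R}^{2d},\mathcal{S}^2)$, then $$\frac{\|\chi_\Omega\cdot\mathfrak{V}_\gamma\rho\|_{L^1(\mathbb{R}^{2d},\mathcal{S}^2)}}{\|\mathfrak{V}_\gamma\rho\|_{L^1(\mathbb{R}^{2d},\mathcal{S}^2)}}\le\theta_{\mathcal{K}}\cdot\sup_{w\in\mathbb{R}^{2d}}\int_\Omega\|\mathcal{K}(z,w)\|_{\mathrm{op}}\,dz,$$ where $$\theta_{\mathcal{K}}:=\sup_{\sigma\in\mathfrak{M}^1\setminus\{0\}}\frac{\|\mathfrak{V}_\gamma\sigma\|_{L^1(\mathbb{R}^{2d},\mathcal{S}^2)}}{\|I_{\mathcal{K}}(\mathfrak{V}_\gamma\sigma)\|_{L^1(\mathbb{R}^{2d},\mathcal{S}^2)}}.$$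
   Context: $\mathcal{S}^2$ is the space of Hilbert–Schmidt operators on $L^2(\mathbb{R}^d)$; $\mathcal{B}(L^2(\mathbb{R}^d))$ the bounded operators with norm $\|\cdot\|_{\mathrm{op}}$. For $z=(x,\omega)\in\mathbb{R}^{2d}$, $(\pi(z)g)(t)=g(t-x)e^{2\pi i\omega\cdot t}$. For $\gamma,\rho\in\mathcal{S}^2$ the operator short-time Fourier transform is $\mathfrak{V}_\gamma\rho(z)=\gamma^*\pi(z)^*\rho\in\mathcal{S}^2$. With $h_0(t)=2^{d/4}e^{-\pi|t|^2}$ and $\gamma_0=h_0\otimes h_0$ (where $(f\otimes g)(h)=\langle h,g\rangle f$), $\mathfrak{M}^1$ is the Banach space of operators $\rho$ with $\mathfrak{V}_{\gamma_0}\rho\in L^1(\mathbb{R}^{2d},\mathcal{S}^2)$ (Bochner space); it is contained in $\mathcal{S}^2$ and also described as $\{\gamma\in\mathcal{S}^2:\mathfrak{V}_\gamma\gamma\in L^1(\mathbb{R}^{2d},\mathcal{S}^2)\}$. For $\gamma\in\mathfrak{M}^1$ nonzero, $\rho\mapsto\|\mathfrak{V}_\gamma\rho\|_{L^1(\mathbb{R}^{2d},\mathcal{S}^2)}$ is an equivalent norm on $\mathfrak{M}^1$. ''Bounded and boundedly invertible on $\mathfrak{V}_\gamma(\mathfrak{M}^1)$'' means that $I_{\mathcal{K}}$ is a bijective bounded linear map of $\mathfrak{V}_\gamma(\mathfrak{M}^1)$ (with the $L^1(\mathbb{R}^{2d},\mathcal{S}^2)$ norm) onto itself with bounded inverse.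 $\chi_\Omega$ is the characteristic function of $\Omega$.
   Formalization: The formal theorem additionally assumes that (z,w) ↦ ‖K(z,w)‖_op is jointly Lebesgue measurable; without this the claim can fail (under the continuum hypothesis, cut the reproducing kernel of V_γ off along a well-ordering of R^{2d}). *)

(* Defs.v *)
From HB Require Import structures.
From mathcomp Require Import all_boot all_order all_algebra.
From mathcomp Require Import generic_quotient ring_quotient.
From mathcomp Require Import all_classical all_reals all_analysis.
From mathcomp Require Import measurable_realfun ring lra.
From mathcomp.real_closed Require Import complex.

Set Implicit Arguments.
Unset Strict Implicit.
Unset Printing Implicit Defensive.
Import Order.TTheory GRing.Theory Num.Theory.
Import numFieldNormedType.Exports.

Local Open Scope classical_set_scope.
Local Open Scope ring_scope.
Local Open Scope complex_scope.

Section LebesgueTuple.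
Variable R : realType.

Definition tuple_cons (n : nat) (p : n.-tuple R * R) : n.+1.-tuple R :=
  [tuple of p.2 :: p.1].

Fixpoint lebesgue_tuple (d : nat) : set (d.-tuple R) -> \bar R :=
  match d with
  | 0%N => \d_[tuple]
  | n.+1 => pushforward (@lebesgue_tuple n \x lebesgue_measure)%E
              (@tuple_cons n)
  end.

Lemma measurable_tuple_cons n : measurable_fun setT (@tuple_cons n).
Proof. exact: measurable_cons. Qed.

Lemma lebesgue_tuple_measure d :
  exists2 m : {measure set (d.-tuple R) -> \bar R},
    @lebesgue_tuple d = m & sigma_finite setT m.
Proof.
elim: d => [|n [m lebm sm]].
  by exists \d_[tuple] => //; exact: sigma_finiteT.
have msnoc := @measurable_tuple_cons n.
pose p : {measure set _ -> \bar R} := (m \x (@lebesgue_measure R))%E.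
pose q := measure_function_pushforward__canonical__measure_function_Measure p msnoc.
exists q; first by rewrite /= lebm.
have /sigma_finiteP [F [TF ndF Foo]] := sm.
have /sigma_finiteP[G [TG ndG Goo]] :=
  sigma_finiteT (@lebesgue_measure R).
exists (fun k => [set t : n.+1.-tuple R |
                   F k [tuple of behead t] /\ G k (thead t)]).
  rewrite predeqE => t; split => // _.
  have [i _ Fi] : (\bigcup_i F i) [tuple of behead t] by rewrite -TF.
  have [j _ Gj] : (\bigcup_i G i) (thead t) by rewrite -TG.
  exists (maxn i j) => //; split.
    by move: Fi; exact/subsetPset/ndF/leq_maxl.
  by move: Gj; exact/subsetPset/ndG/leq_maxr.
move=> k; have [mF Fk] := Foo k; have [mG Gk] := Goo k.
split.
  rewrite (_ : [set _ | _] =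
      (fun t : n.+1.-tuple R => [tuple of behead t]) @^-1` F k `&`
      (fun t => tnth t ord0) @^-1` G k) //.
  apply: measurableI; rewrite -[X in measurable X]setTI.
    exact: measurable_behead.
  exact: measurable_tnth.
rewrite /= /pushforward (_ : _ @^-1` _ = F k `*` G k); last first.
  have beheadE (x : n.-tuple R) (y : R) : [tuple of behead (y :: x)] = x.
    exact/val_inj.
  by apply/seteqP; split=> -[x y]; rewrite /tuple_cons /preimage/= theadE beheadE.
by rewrite product_measure1E// lte_mul_pinfty// ge0_fin_numE.
Qed.

Section instances.
Variable d : nat.

Let leb0 : @lebesgue_tuple d set0 = 0%E.
Proof. by have [m -> _] := lebesgue_tuple_measure d; exact: measure0. Qed.

Let leb_ge0 A : (0 <= @lebesgue_tuple d A)%E.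
Proof. by have [m -> _] := lebesgue_tuple_measure d. Qed.

Let leb_sigma_additive : semi_sigma_additive (@lebesgue_tuple d).
Proof.
by have [m -> _] := lebesgue_tuple_measure d;
  exact: measure_semi_sigma_additive.
Qed.

HB.instance Definition _ := isMeasure.Build _ _ _ (@lebesgue_tuple d)
  leb0 leb_ge0 leb_sigma_additive.

Let leb_sigma_finite : sigma_finite setT (@lebesgue_tuple d).
Proof. by have [m -> ?] := lebesgue_tuple_measure d. Qed.

HB.instance Definition _ := Measure_isSigmaFinite.Build _ _ _
  (@lebesgue_tuple d) leb_sigma_finite.

End instances.
End LebesgueTuple.

Section L2.
Context d (T : measurableType d) (R : realType).
Variable mu : {measure set T -> \bar R}.

Definition abs2 (z : R[i]) : R := complex.Re z ^+ 2 + complex.Im z ^+ 2.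

Definition square_integrable : {pred T -> R[i]} :=
  mem [set f | [/\ measurable_fun setT (fun x => complex.Re (f x)),
                   measurable_fun setT (fun x => complex.Im (f x)) &
                   (\int[mu]_x (abs2 (f x))%:E < +oo)%E]].

Lemma abs2_ge0 z : 0 <= abs2 z.
Proof. by rewrite addr_ge0// sqr_ge0. Qed.

Lemma measurable_abs2 (f : T -> R[i]) :
  measurable_fun setT (fun x => complex.Re (f x)) ->
  measurable_fun setT (fun x => complex.Im (f x)) ->
  measurable_fun setT (fun x => abs2 (f x)).
Proof. by move=> mr mi; apply: measurable_funD; exact: measurable_funX. Qed.

Lemma square_integrable_submod : submod_closed square_integrable.
Proof.
split.
  rewrite inE/=; split; [exact: measurable_cst|exact: measurable_cst|].
  by rewrite integral0_eq// => x _; rewrite /abs2/= !expr0n/= addr0.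
move=> a f g; rewrite !inE/= => -[rf jf intf] [rg jg intg].
have ReE x : complex.Re ((a *: f + g) x) =
    complex.Re a * complex.Re (f x) - complex.Im a * complex.Im (f x) +
    complex.Re (g x).
  rewrite [(a *: f + g) x]/(a * f x + g x).
  by move: (a) (f x) (g x) => [p q] [u v] [s t].
have ImE x : complex.Im ((a *: f + g) x) =
    complex.Re a * complex.Im (f x) + complex.Im a * complex.Re (f x) +
    complex.Im (g x).
  rewrite [(a *: f + g) x]/(a * f x + g x).
  by move: (a) (f x) (g x) => [p q] [u v] [s t].
have mr : measurable_fun setT (fun x => complex.Re ((a *: f + g) x)).
  under eq_fun do rewrite ReE.
  by apply: measurable_funD => //; apply: measurable_funB;
    apply: measurable_funM.
have mi : measurable_fun setT (fun x => complex.Im ((a *: f + g) x)).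
  under eq_fun do rewrite ImE.
  by apply: measurable_funD => //; apply: measurable_funD;
    apply: measurable_funM.
split => //.
pose h x : \bar R :=
  ((2 * abs2 a)%:E * (abs2 (f x))%:E + 2%:E * (abs2 (g x))%:E)%E.
have mf2 : measurable_fun setT (fun x => (abs2 (f x))%:E).
  by apply/measurable_EFinP; exact: measurable_abs2.
have mg2 : measurable_fun setT (fun x => (abs2 (g x))%:E).
  by apply/measurable_EFinP; exact: measurable_abs2.
have mfg2 : measurable_fun setT (fun x => (abs2 ((a *: f + g) x))%:E).
  by apply/measurable_EFinP; exact: measurable_abs2.
have a2 : 0 <= 2 * abs2 a by rewrite mulr_ge0// abs2_ge0.
apply: (@le_lt_trans _ _ (\int[mu]_x h x)%E).
  apply: ge0_le_integral => //.
  - by move=> x _; rewrite lee_fin abs2_ge0.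
  - exact: emeasurable_funD (measurable_funeM _ mf2) (measurable_funeM _ mg2).
  - move=> x _; rewrite /h -!EFinM -EFinD lee_fin /abs2 ReE ImE.
    have key (p q u v s t : R) :
        (p * u - q * v + s) ^+ 2 + (p * v + q * u + t) ^+ 2 <=
        2 * (p ^+ 2 + q ^+ 2) * (u ^+ 2 + v ^+ 2) + 2 * (s ^+ 2 + t ^+ 2).
      rewrite -subr_ge0 (_ : _ - _ = (p * u - q * v - s) ^+ 2 +
        (p * v + q * u - t) ^+ 2); first by rewrite addr_ge0// sqr_ge0.
      by ring.
    exact: key.
rewrite /h ge0_integralD//;
  do ?[exact: measurable_funeM|
       by move=> x _; rewrite mule_ge0// lee_fin// abs2_ge0].
rewrite !ge0_integralZl//; do ?[by move=> x _; rewrite lee_fin abs2_ge0].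
by rewrite lte_add_pinfty// lte_mul_pinfty.
Qed.

HB.instance Definition _ := GRing.isSubmodClosed.Build R[i] (T -> R[i])
  square_integrable square_integrable_submod.

Definition L2fun : Type := {f : T -> R[i] | f \in square_integrable}.
HB.instance Definition _ := SubType.on L2fun.
HB.instance Definition _ := [Choice of L2fun by <:].
HB.instance Definition _ := [SubChoice_isSubLmodule of L2fun by <:].

Definition ae_zero : {pred L2fun} :=
  mem [set f : L2fun | val f = 0 %[ae mu]].

Lemma ae_zero_submod : submod_closed ae_zero.
Proof.
split; first by rewrite inE/=; exact: aeW.
move=> a f g; rewrite !inE/= => f0 g0; apply: filterS2 f0 g0 => x fx gx _.
transitivity (a * sval f x + sval g x) => //.
by rewrite (fx I) (gx I) [a * _]mulr0 addr0.
Qed.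

HB.instance Definition _ := GRing.isSubmodClosed.Build R[i] L2fun
  ae_zero ae_zero_submod.

(* Square-integrable functions modulo equality almost everywhere; Borel
   functions suffice since each class has a Borel representative. *)
Definition L2 : Type := Quotient.quot ae_zero.
HB.instance Definition _ := Choice.on L2.
HB.instance Definition _ := EqQuotient.on L2.
HB.instance Definition _ := GRing.Zmodule.on L2.

Local Notation piL2 := (\pi_L2)%qT.

Definition L2_scale (a : R[i]) (u : L2) : L2 := piL2 (a *: (repr u : L2fun)).

Let scale_pi a (f : L2fun) : L2_scale a (piL2 f) = piL2 (a *: f).
Proof.
apply/eqP; rewrite -Quotient.idealrBE -scalerBr; apply: rpredZ.
by rewrite Quotient.idealrBE reprK.
Qed.

Let add_pi (f g : L2fun) : piL2 f + piL2 g = piL2 (f + g).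
Proof. exact/esym/(Quotient.pi_add ae_zero f g). Qed.

Let piP (u : L2) : exists f : L2fun, u = piL2 f.
Proof. by exists (repr u); rewrite reprK. Qed.

Let scaleA a b u : L2_scale a (L2_scale b u) = L2_scale (a * b) u.
Proof. by have [f ->] := piP u; rewrite !scale_pi scalerA. Qed.

Let scale1 : left_id 1 L2_scale.
Proof. by move=> u; have [f ->] := piP u; rewrite scale_pi scale1r. Qed.

Let scaleDr : right_distributive L2_scale +%R.
Proof.
move=> a u v; have [f ->] := piP u; have [g ->] := piP v.
by rewrite add_pi !scale_pi add_pi scalerDr.
Qed.

Let scaleDl u : {morph L2_scale^~ u : a b / a + b}.
Proof.
by move=> a b; have [f ->] := piP u; rewrite !scale_pi add_pi scalerDl.
Qed.

HB.instance Definition _ := GRing.Zmodule_isLmodule.Build R[i] L2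
  scaleA scale1 scaleDr scaleDl.

End L2.

Section L2Hilbert.
Context d (T : measurableType d) (R : realType).
Variable mu : {measure set T -> \bar R}.
Local Notation H := (L2 mu).

Definition L2val (u : H) : T -> R[i] := val (repr u : L2fun mu).

(* Functions that are not square-integrable are sent to the junk value 0. *)
Definition L2class (f : T -> R[i]) : H :=
  if insub f is Some g then \pi_H%qT (g : L2fun mu) else 0.

Definition inner (u v : H) : R[i] :=
  let p x := L2val u x * (L2val v x)^*%C in
  (\int[mu]_x complex.Re (p x)) +i* (\int[mu]_x complex.Im (p x)).

Definition L2norm (u : H) : R := Num.sqrt (complex.Re (inner u u)).

Definition bounded_op : set (H -> H) :=
  [set A | linear A /\ exists C : R, forall u, L2norm (A u) <= C * L2norm u].

Definition op_norm (A : H -> H) : \bar R :=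
  ereal_sup [set (L2norm (A u))%:E | u in [set u | L2norm u <= 1]].

(* The junk value 0 is only taken when [A] has no adjoint, which does not happen
   for a bounded operator. *)
Definition adjoint (A : H -> H) : H -> H :=
  xget 0 [set B | bounded_op B /\ forall u v, inner (A u) v = inner u (B v)].

Definition rank_one (f g : H) : H -> H := fun h => inner h g *: f.

Definition orthonormal_basis : set (set H) :=
  [set E | (forall e f, E e -> E f -> inner e f = (e == f)%:R) /\
           forall u, (forall e, E e -> inner u e = 0) -> u = 0].

(* The sum over an orthonormal basis does not depend on the basis, so the
   supremum below is the common value. *)
Definition hs_norm (A : H -> H) : \bar R :=
  sqrte (ereal_sup [set \esum_(e in E) (L2norm (A e) ^+ 2)%:E
                   | E in orthonormal_basis]).

Definition hilbert_schmidt : set (H -> H) :=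
  [set A | bounded_op A /\ (hs_norm A < +oo)%E].

End L2Hilbert.

(* Bochner integration with values in the normed space consisting of the
   subspace [S] of [V] with the norm [N]. *)
Section Bochner.
Context d (Z : measurableType d) (R : realType).
Variable nu : {measure set Z -> \bar R}.
Variables (V : lmodType R[i]) (S : set V) (N : V -> \bar R).
Implicit Types (s F : Z -> V) (v : V).

Definition simple_function s :=
  [/\ finite_set (range s),
      forall v, measurable (s @^-1` [set v]),
      forall v, v != 0 -> (nu (s @^-1` [set v]) < +oo)%E &
      forall z, S (s z)].

Definition simple_integral s : V :=
  \sum_(v \in range s) (fine (nu (s @^-1` [set v])))%:C *: v.

Definition strongly_measurable F :=
  {ae nu, forall z, S (F z)} /\
  exists2 s : nat -> Z -> V, (forall n, simple_function (s n)) &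
    {ae nu, forall z, N (F z - s n z) @[n --> \oo] --> 0%E}.

Definition is_bochner_integral F v :=
  [/\ S v, strongly_measurable F &
      exists s : nat -> Z -> V,
        [/\ forall n, simple_function (s n),
            (\int[nu]_z N (F z - s n z))%E @[n --> \oo] --> 0%E &
            N (v - simple_integral (s n)) @[n --> \oo] --> 0%E]].

Definition bochner_integrable F := exists v, is_bochner_integral F v.

Definition bochner_integral F : V := xget 0 (is_bochner_integral F).

Definition bochner_L1norm F : \bar R := (\int[nu]_z N (F z))%E.

Definition bochner_L1 : set (Z -> V) :=
  [set F | strongly_measurable F /\ (bochner_L1norm F < +oo)%E].

(* [I] induces a bijection, bounded with bounded inverse, of the set of
   almost-everywhere classes of elements of [X] onto itself. *)
Definition boundedly_invertible_on (X : set (Z -> V))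
    (I : (Z -> V) -> (Z -> V)) :=
  [/\ forall F, X F -> exists2 G, X G & I F = G %[ae nu],
      forall F G, X F -> X G -> I F = I G %[ae nu] -> F = G %[ae nu],
      forall G, X G -> exists2 F, X F & I F = G %[ae nu],
      exists C : R, forall F, X F ->
        (bochner_L1norm (I F) <= C%:E * bochner_L1norm F)%E &
      exists C : R, forall F, X F ->
        (bochner_L1norm F <= C%:E * bochner_L1norm (I F))%E].

End Bochner.

(* Measurability with respect to the completion of [nu] (Lebesgue rather than
   Borel measurability when [nu] is a Lebesgue measure). *)
Definition completion_measurable_fun d (T : measurableType d) (R : realType)
    (nu : {measure set T -> \bar R}) (f : T -> \bar R) :=
  exists2 g : T -> \bar R, measurable_fun setT g & f = g %[ae nu].

Section OperatorSTFT.
Variables (R : realType) (d : nat).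

Definition leb : {sigma_finite_measure set (d.-tuple R) -> \bar R} :=
  @lebesgue_tuple R d.

Local Notation phase := (d.-tuple R * d.-tuple R)%type.

Definition leb2 : set phase -> \bar R := (leb \x leb)%E.
HB.instance Definition _ := Measure.on leb2.

(* The library's sigma-finite instance on products of measures is not found by
   inference. *)
Let leb2_sigma_finite : sigma_finite setT leb2.
Proof.
have /sigma_finiteP[F [TF ndF Foo]] := sigma_finiteT leb.
exists (fun n => F n `*` F n).
  rewrite -setXTT TF predeqE => -[x y]; split.
    move=> [/= [n _ Fnx] [k _ Fky]]; exists (maxn n k) => //; split.
    - by move: x Fnx; exact/subsetPset/ndF/leq_maxl.
    - by move: y Fky; exact/subsetPset/ndF/leq_maxr.
  by move=> [n _ []/= ? ?]; split; exists n.
move=> k; have [mF Fk] := Foo k.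
split; first exact: measurableX.
by rewrite /leb2 product_measure1E// lte_mul_pinfty// ge0_fin_numE.
Qed.

HB.instance Definition _ := Measure_isSigmaFinite.Build _ _ _ leb2
  leb2_sigma_finite.

Definition leb4 : {measure set (phase * phase) -> \bar R} := (leb2 \x leb2)%E.

Local Notation H := (L2 leb).

Definition dot (s t : d.-tuple R) : R := \sum_(i < d) tnth s i * tnth t i.

Definition translate (t x : d.-tuple R) : d.-tuple R :=
  [tuple tnth t i - tnth x i | i < d].

Definition expi (a : R) : R[i] := cos a +i* sin a.

Definition tf_shift (z : phase) (g : H) : H :=
  L2class leb (fun t => expi (2 * pi * dot z.2 t) * L2val g (translate t z.1)).

Definition stft (gamma rho : H -> H) (z : phase) : H -> H :=
  adjoint gamma \o (adjoint (tf_shift z) \o rho).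

Definition h0 : H :=
  L2class leb (fun t => (2 `^ (d%:R / 4) * expR (- (pi * dot t t)))%:C).

Definition gamma0 : H -> H := rank_one h0 h0.

Definition L1S2norm (F : phase -> H -> H) : \bar R :=
  bochner_L1norm leb2 (@hs_norm _ _ _ leb) F.

Definition L1S2 : set (phase -> H -> H) :=
  bochner_L1 leb2 (@hilbert_schmidt _ _ _ leb) (@hs_norm _ _ _ leb).

Definition M1 : set (H -> H) :=
  [set rho | hilbert_schmidt rho /\ L1S2 (stft gamma0 rho)].

Definition integrable_kernel_at (K : phase -> phase -> H -> H)
    (F : phase -> H -> H) (z : phase) :=
  bochner_integrable leb2 (@hilbert_schmidt _ _ _ leb) (@hs_norm _ _ _ leb)
    (fun w => K z w \o F w).

Definition kernel_op (K : phase -> phase -> H -> H) (F : phase -> H -> H)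
    (z : phase) : H -> H :=
  bochner_integral leb2 (@hilbert_schmidt _ _ _ leb) (@hs_norm _ _ _ leb)
    (fun w => K z w \o F w).

Definition theta (gamma : H -> H) (K : phase -> phase -> H -> H) : \bar R :=
  ereal_sup [set (L1S2norm (stft gamma sigma) /
                  L1S2norm (kernel_op K (stft gamma sigma)))%E
            | sigma in M1 `\ (0 : H -> H)].

End OperatorSTFT.

Arguments leb2 : clear implicits.
Arguments M1 : clear implicits.

(* Main.v *)
Require Import Defs.
From HB Require Import structures.
From mathcomp Require Import all_boot all_order all_algebra.
From mathcomp Require Import all_classical all_reals all_analysis.
From mathcomp Require Import measurable_realfun complex ring.

Set Implicit Arguments.
Unset Strict Implicit.
Unset Printing Implicit Defensive.
Import Order.TTheory GRing.Theory Num.Theory.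
Import numFieldNormedType.Exports.

Local Open Scope classical_set_scope.
Local Open Scope ring_scope.
Local Open Scope complex_scope.

(** Write [N] for the Hilbert-Schmidt norm and [F] for the transform of [rho].
    Surjectivity of [I_K] gives [sigma] in [M1] whose transform [G] satisfies
    [I_K G = F] almost everywhere.  Then
      [N (F z) <= \int N (K z w o G w) dw <= \int |K z w| N (G w) dw],
    and integrating over [Omega] and exchanging the integrals gives
      [|chi_Omega F| <= S |G|],  with  [S = sup_w \int_Omega |K z w| dz].
    Since [|G| / |F| = |G| / |I_K G|] is one of the quotients whose supremum is
    [theta], dividing by [|F|] concludes.  [sigma] is nonzero because [I_K] is
    bounded: [sigma = 0] would give [|F| <= C |G| = 0].  If [|F|] is [0] or
    [+oo], the left-hand side is [0] ([ediv_le_mul]).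

    Three points need an argument.

    - Exchanging the integrals requires the function [w |-> N (G w)] to be
      measurable, which is far from immediate.  The integral of a nonnegative
      function [f], measurable or not, is its lower integral, which is attained
      by a measurable minorant [g <= f]
      ([lower_integral_attained]).  If the lower integral is finite, every
      measurable minorant of [f] is at most [g] almost everywhere, and so every
      measurable [n <= k f] with [k] measurable satisfies [n <= k g] almost
      everywhere ([ae_le_mul_lower_integral_attained]).  Here
      [n w = N (K z w o G w)] is measurable up to a null set, because [I_K] is
      a Bochner integral, and [k w = |K z w|].  After this replacement only
      measurable functions remain and Tonelli applies ([schur_bound]).

    - The norm of a Bochner integral is at most the integral of the norm.  This
      holds for every seminorm, even with value [+oo]
      ([eseminorm_bochner_integral]).

    - [N] is such a seminorm and [N (A o B) <= |A| N (B)].  The triangle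
      inequality comes from the pointwise bound
        [|a + b|^2 <= (1 + t) |a|^2 + (1 + t^-1) |b|^2]  for all [t > 0],
      which passes to integrals, sums over a basis and suprema over bases, and
      from which square roots can be extracted at the very end
      ([sqrte_leD]). *)

(** * Integrals of nonnegative functions that need not be measurable *)

Section lower_integral.
Local Open Scope ereal_scope.
Context d (T : measurableType d) (R : realType).
Variable mu : {measure set T -> \bar R}.
Implicit Types f g h u : T -> \bar R.
Import HBNNSimple.

Lemma ge0_le_lower_integral f g : (forall x, 0 <= f x) ->
  (forall x, f x <= g x) -> \int[mu]_x f x <= \int[mu]_x g x.
Proof.
move=> f0 fg; rewrite !ge0_integralTE//; last first.
  by move=> x; exact: le_trans (fg x).
apply: le_ereal_sup => _ [h hf <-]; exists h => // x.
exact: le_trans (fg x).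
Qed.

(** The integral is the supremum of the integrals of the simple functions below
    [f]; the supremum of a maximizing sequence of these is measurable, stays
    below [f] and has the integral of [f]. *)
Lemma lower_integral_attained f : (forall x, 0 <= f x) ->
  exists g, [/\ measurable_fun setT g, forall x, 0 <= g x,
    forall x, g x <= f x & \int[mu]_x g x = \int[mu]_x f x].
Proof.
move=> f0.
pose S := [set sintegral mu h |
  h in [set h : {nnsfun T >-> R} | forall x, (h x)%:E <= f x]].
have S0 : S != set0.
  apply/set0P; exists (sintegral mu (nnsfun0 : {nnsfun T >-> R})).
  by exists nnsfun0.
have [v Sv vS] := ereal_sup_seq S0.
have /choice[h hP] : forall n, exists h : {nnsfun T >-> R},
    (forall x, (h x)%:E <= f x) /\ sintegral mu h = v n.
  by move=> n; have [h hf hv] := Sv n; exists h.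
have mh n : measurable_fun setT (EFin \o h n) by exact/measurable_EFinP.
pose g x := esups (fun n => (h n x)%:E) 0%N.
have gf x : g x <= f x.
  by apply: ge_ereal_sup => _ [n _ <-]; have [] := hP n.
have hg n x : (h n x)%:E <= g x by apply: ereal_sup_ubound; exists n.
have g0 x : 0 <= g x by apply: le_trans (hg 0%N x); rewrite lee_fin.
exists g; split => //.
  exact: (measurable_fun_esups mh).
apply/eqP; rewrite eq_le ge0_le_lower_integral//=.
have -> : \int[mu]_x f x = ereal_sup S by rewrite ge0_integralTE.
rewrite -(cvg_lim _ vS)//; apply: lime_le.
  by apply/cvg_ex; eexists; exact: vS.
apply: nearW => n; have [_ <-] := hP n.
have -> : sintegral mu (h n) = \int[mu]_x (h n x)%:E.
  by rewrite integral_nnsfun// patch_setT.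
by apply: ge0_le_lower_integral => // x; rewrite lee_fin.
Qed.

(** A null set does not matter even for lower integrals: it can be removed from
    the measurable minorant that computes the integral of [f]. *)
Lemma ae_ge0_le_lower_integral f g : (forall x, 0 <= f x) ->
  (forall x, 0 <= g x) -> {ae mu, forall x, f x <= g x} ->
  \int[mu]_x f x <= \int[mu]_x g x.
Proof.
move=> f0 g0 [N [mN N0 fgN]].
have [h [mh h0 hf <-]] := lower_integral_attained f0.
rewrite (ge0_negligible_integral mN)// setTD integral_mkcond.
apply: ge0_le_lower_integral => x; rewrite patchE; case: ifPn => // /set_mem xN.
apply: le_trans (hf x) _; apply: contrapT => fgx; apply: xN; exact: fgN.
Qed.

Lemma ae_eq_lower_integral f g : (forall x, 0 <= f x) ->
  (forall x, 0 <= g x) -> {ae mu, forall x, f x = g x} ->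
  \int[mu]_x f x = \int[mu]_x g x.
Proof.
move=> f0 g0 fg; apply/eqP; rewrite eq_le.
by rewrite !ae_ge0_le_lower_integral//; apply: filterS fg => x ->.
Qed.

(** Lower integrals are superadditive; subadditivity survives here because the
    positive part of [f - g] is a measurable minorant of [u]. *)
Lemma le_lower_integralD f u g : measurable_fun setT f ->
  measurable_fun setT g -> (forall x, 0 <= f x) -> (forall x, 0 <= u x) ->
  (forall x, 0 <= g x) -> {ae mu, forall x, f x <= u x + g x} ->
  \int[mu]_x f x <= \int[mu]_x u x + \int[mu]_x g x.
Proof.
move=> mf mg f0 u0 g0 fug.
pose h x := maxe (f x - g x) 0.
have mh : measurable_fun setT h.
  by apply: measurable_maxe => //; exact: emeasurable_funB.
have h0 x : 0 <= h x by rewrite /h le_max lexx orbT.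
have hu : \int[mu]_x h x <= \int[mu]_x u x.
  apply: ae_ge0_le_lower_integral => //; apply: filterS fug => x fug.
  rewrite /h ge_max u0 andbT; move: fug (g0 x).
  case: (g x) => [b| |] //; first by rewrite leeBlDr.
  by move=> *; rewrite /= addeNy leNye.
apply: le_trans (leeD hu (lexx _)); rewrite -ge0_integralD//.
apply: ge0_le_lower_integral => // x; rewrite /h; move: (g0 x).
case: (g x) => [b _|_|//].
  apply: (@le_trans _ _ (f x - b%:E + b%:E)); first by rewrite subeK.
  by rewrite leeD2r// le_max lexx.
rewrite addey ?leey// gt_eqF// (lt_le_trans ltNy0)//.
by rewrite le_max lexx orbT.
Qed.

(** A minorant attaining a finite lower integral is the largest one up to null
    sets: the maximum of [g] and [h] is again a minorant, hence has the same
    finite integral as [g]. *)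
Lemma ae_le_lower_integral_attained f g h : (forall x, 0 <= f x) ->
  \int[mu]_x f x < +oo ->
  measurable_fun setT g -> (forall x, 0 <= g x) -> (forall x, g x <= f x) ->
  \int[mu]_x g x = \int[mu]_x f x ->
  measurable_fun setT h -> (forall x, 0 <= h x) ->
  {ae mu, forall x, h x <= f x} -> {ae mu, forall x, h x <= g x}.
Proof.
move=> f0 foo mg g0 gf gfE mh h0 hf.
pose m x := maxe (g x) (h x).
have mm : measurable_fun setT m by exact: measurable_maxe.
have m0 x : 0 <= m x by rewrite le_max g0.
have mfE : \int[mu]_x m x = \int[mu]_x g x.
  apply/eqP; rewrite eq_le; apply/andP; split.
    rewrite gfE; apply: ae_ge0_le_lower_integral => //.
    by apply: filterS hf => x hf; rewrite ge_max gf.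
  by apply: ge0_le_lower_integral => // x; rewrite le_max lexx.
have ig : mu.-integrable setT g.
  apply/integrableP; split => //.
  by under eq_integral do rewrite gee0_abs//; rewrite gfE.
have im : mu.-integrable setT m.
  apply/integrableP; split => //.
  by under eq_integral do rewrite gee0_abs//; rewrite mfE gfE.
have d0 x : 0 <= m x - g x \/ g x = +oo.
  have [gx|] := boolP (g x \is a fin_num); last first.
    by rewrite ge0_fin_numE// -leNgt leye_eq => /eqP ->; right.
  by left; rewrite leeBrDr// add0e le_max lexx.
have /integrable_ae gfin := ig.
have /(_ measurableT) {}gfin := gfin.
have int0 : \int[mu]_x `|m x - g x| = 0.
  transitivity (\int[mu]_x (m x - g x)).
    apply: ae_eq_integral => //.
    - by apply: measurableT_comp => //; exact: emeasurable_funB.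
    - exact: emeasurable_funB.
    - apply: filterS gfin => x gx _; rewrite gee0_abs//.
      by have [//|E] := d0 x; have := gx I; rewrite E.
  rewrite integralB// mfE subee// ge0_fin_numE ?integral_ge0//.
  by rewrite gfE.
have : ae_eq mu setT (fun x => m x - g x) (cst 0).
  apply/ae_eq_integral_abs => //; exact: emeasurable_funB.
move=> mg0; apply: filterS2 gfin mg0 => x gx mg0.
rewrite -[leRHS]add0e -[X in X + _]/(cst 0 x) -(mg0 I) subeK ?gx//.
by rewrite le_max lexx orbT.
Qed.

(** Where [k] does not vanish, [n / k] is a measurable minorant of [f], so it is
    at most [g]; where [k] vanishes, so does [n]. *)
Lemma ae_le_mul_lower_integral_attained f g (n : T -> \bar R) (k : T -> R) :
  (forall x, 0 <= f x) -> \int[mu]_x f x < +oo ->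
  measurable_fun setT g -> (forall x, 0 <= g x) -> (forall x, g x <= f x) ->
  \int[mu]_x g x = \int[mu]_x f x ->
  measurable_fun setT n -> (forall x, 0 <= n x) ->
  measurable_fun setT k -> (forall x, (0 <= k x)%R) ->
  {ae mu, forall x, n x <= (k x)%:E * f x} ->
  {ae mu, forall x, n x <= (k x)%:E * g x}.
Proof.
move=> f0 foo mg g0 gf gfE mn n0 mk k0 nkf.
(* The power with exponent -1 is the inverse, with value 0 at 0. *)
pose h x := n x * ((k x `^ (-1))%R)%:E.
have kV x : (k x `^ (-1) = (k x)^-1)%R by rewrite powRN powRr1.
have mh : measurable_fun setT h.
  apply: emeasurable_funM => //; apply/measurable_EFinP.
  exact: measurableT_comp (measurable_powR _) mk.
have h0 x : 0 <= h x by rewrite mule_ge0// lee_fin powR_ge0.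
have : {ae mu, forall x, h x <= g x}.
  apply: (ae_le_lower_integral_attained f0) => //.
  apply: filterS nkf => x nkf; rewrite /h kV.
  have [kx0|kx0] := eqVneq (k x) 0%R; first by rewrite kx0 invr0 mule0.
  have kx : (0 < k x)%R by rewrite lt_neqAle eq_sym kx0 k0.
  by rewrite lee_pdivrMr// muleC.
apply: filterS2 nkf => x nkf; rewrite /h kV.
have [kx0|kx0] := eqVneq (k x) 0%R; first by rewrite kx0 !mul0e in nkf *.
have kx : (0 < k x)%R by rewrite lt_neqAle eq_sym kx0 k0.
by rewrite lee_pdivrMr// muleC.
Qed.

End lower_integral.

(** * Tonelli and the Schur bound *)

Section ae_section.
Local Open Scope ereal_scope.
Context d1 d2 (T1 : measurableType d1) (T2 : measurableType d2) (R : realType).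
Variable m1 : {sigma_finite_measure set T1 -> \bar R}.
Variable m2 : {sigma_finite_measure set T2 -> \bar R}.

(** Tonelli applied to the indicator of a null set: almost all of its sections
    have measure zero. *)
Lemma ae_sections (m12 : {measure set (T1 * T2) -> \bar R})
    (P : T1 * T2 -> Prop) :
  (m12 : set (T1 * T2) -> \bar R) = (m1 \x m2) -> {ae m12, forall p, P p} ->
  {ae m1, forall x, {ae m2, forall y, P (x, y)}} /\
  {ae m2, forall y, {ae m1, forall x, P (x, y)}}.
Proof.
move=> m12E [N [mN N0 PN]].
pose h p : \bar R := (\1_N p)%:E.
have mh : measurable_fun setT h.
  by apply/measurable_EFinP; exact: measurable_indic.
have h0 p : 0 <= h p by rewrite lee_fin.
have inth : \int[m1 \x m2]_p h p = 0.
  by rewrite integral_indic// setIT -[LHS]/((m1 \x m2) N) -m12E.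
have hP p : h p = 0 -> P p.
  move=> [] hp; apply: contrapT => NPp; move: hp.
  by rewrite indicE mem_set => [/eqP|]; [rewrite oner_eq0|exact: PN].
split.
  move: inth; rewrite fubini_tonelli1// => inth.
  have F0 x : 0 <= \int[m2]_y h (x, y) by exact: integral_ge0.
  have : ae_eq m1 setT (fun x => \int[m2]_y h (x, y)) (cst 0).
    apply/ae_eq_integral_abs => //.
      exact: (measurable_fun_fubini_tonelli_F h).
    by under eq_integral do rewrite gee0_abs//.
  apply: filterS => x /(_ I) /= hx.
  have : ae_eq m2 setT (fun y => h (x, y)) (cst 0).
    apply/ae_eq_integral_abs => //.
      exact: (measurableT_comp mh (measurable_pair1 x)).
    by under eq_integral do rewrite gee0_abs//.
  by apply: filterS => y /(_ I) /hP.
move: inth; rewrite fubini_tonelli2// => inth.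
have F0 y : 0 <= \int[m1]_x h (x, y) by exact: integral_ge0.
have : ae_eq m2 setT (fun y => \int[m1]_x h (x, y)) (cst 0).
  apply/ae_eq_integral_abs => //.
    exact: (measurable_fun_fubini_tonelli_G h).
  by under eq_integral do rewrite gee0_abs//.
apply: filterS => y /(_ I) /= hy.
have : ae_eq m1 setT (fun x => h (x, y)) (cst 0).
  apply/ae_eq_integral_abs => //.
    exact: (measurableT_comp mh (measurable_pair2 y)).
  by under eq_integral do rewrite gee0_abs//.
by apply: filterS => x /(_ I) /hP.
Qed.

End ae_section.

Section schur.
Local Open Scope ereal_scope.
Context d (Z : measurableType d) (R : realType).
Variable nu : {sigma_finite_measure set Z -> \bar R}.

(** The bound of an integral operator on [L1] by the supremum of the integrals
    of its kernel [k] over the first variable.  The functions [n z], measurable up to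
    a null set, stand between [u z] and the possibly nonmeasurable product
    [k (z, _) * f]; they allow [f] to be replaced by a measurable minorant with
    the same integral. *)
Lemma schur_bound (nu2 : {measure set (Z * Z) -> \bar R})
    (k : Z * Z -> R) (f u : Z -> \bar R) (n : Z -> Z -> \bar R)
    (Omega : set Z) :
  (nu2 : set (Z * Z) -> \bar R) = nu \x nu ->
  (forall p, (0 <= k p)%R) ->
  completion_measurable_fun nu2 (EFin \o k) ->
  (forall w, 0 <= f w) -> \int[nu]_w f w < +oo ->
  (forall z, 0 <= u z) ->
  {ae nu, forall z, [/\ completion_measurable_fun nu (n z),
     forall w, 0 <= n z w <= (k (z, w))%:E * f w &
     u z <= \int[nu]_w n z w]} ->
  completed_algebra_gen nu Omega ->
  \int[nu]_z ((\1_Omega z)%:E * u z) <=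
  ereal_sup (range (fun w => \int[nu]_(z in Omega) (k (z, w))%:E)) *
  \int[nu]_w f w.
Proof.
move=> nu2E k0 [k1 mk1 kk1] f0 foo u0 un [A mA [N [N1 [mN1 N10 NN1]] AN]].
set S := ereal_sup _.
have S0 : 0 <= S.
  apply: (@le_trans _ _ (\int[nu]_(z in Omega) (k (z, point))%:E)).
    by apply: integral_ge0 => z _; rewrite lee_fin.
  by apply: ereal_sup_ubound; exists point.
have [g [mg g0 gf gfE]] := lower_integral_attained nu f0.
(* A real, nonnegative, measurable representative of [k]. *)
pose k' p := `|fine (k1 p)|%R.
have k'0 p : (0 <= k' p)%R by exact: normr_ge0.
have mk' : measurable_fun setT k'.
  by apply: measurableT_comp => //; exact: measurableT_comp mk1.
have kk' : {ae nu2, forall p, k p = k' p}.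
  by apply: filterS kk1 => p /(_ I) /= kE; rewrite /k' -kE ger0_norm /=.
have [kk'1 kk'2] := ae_sections nu2E kk'.
have OA : {ae nu, forall z, \1_Omega z = \1_A z :> R}.
  exists N1; split => // z /= zOA; apply: NN1; apply: contrapT => nN.
  apply: zOA; rewrite !indicE; congr (_%:R); rewrite -AN.
  congr nat_of_bool; apply/idP/idP; rewrite !inE /setU/=; first by case.
  by left.
pose H p := (\1_A p.1)%:E * ((k' p)%:E * g p.2).
have mH : measurable_fun setT H.
  apply: emeasurable_funM.
    apply/measurable_EFinP; apply: measurableT_comp => //.
  apply: emeasurable_funM; first exact/measurable_EFinP.
  exact: measurableT_comp.
have H0 p : 0 <= H p by rewrite mule_ge0 ?lee_fin// mule_ge0 ?lee_fin.
apply: (@le_trans _ _ (\int[nu]_z \int[nu]_w H (z, w))).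
  apply: ae_ge0_le_lower_integral.
  - by move=> z; rewrite mule_ge0 ?lee_fin.
  - by move=> z; exact: integral_ge0.
  apply: filterS3 un kk'1 OA => z [[n' mn' nn'] nk un] kz ->.
  have mk'z : measurable_fun setT (fun w => k' (z, w)).
    exact: measurableT_comp mk' (measurable_pair1 z).
  rewrite /H /= ge0_integralZl//; last 2 first.
  - by apply: emeasurable_funM => //; exact/measurable_EFinP.
  - by move=> w _; rewrite mule_ge0 ?lee_fin.
  apply: lee_pmul => //.
  apply: le_trans un _.
  have n0 w : 0 <= n z w by have /andP[] := nk w.
  apply: ae_ge0_le_lower_integral => //.
    by move=> w; rewrite mule_ge0 ?lee_fin.
  suff : {ae nu, forall w, `|n' w| <= (k' (z, w))%:E * g w}.
    by apply: filterS2 nn' => w /(_ I) <-; rewrite gee0_abs.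
  apply: (ae_le_mul_lower_integral_attained f0) => //.
    exact: measurableT_comp.
  apply: filterS2 nn' kz => w /(_ I) <- <-.
  by rewrite gee0_abs//; have /andP[] := nk w.
rewrite fubini_tonelli// -gfE muleC -ge0_integralZr//.
apply: ae_ge0_le_lower_integral.
- by move=> w; exact: integral_ge0.
- by move=> w; rewrite mule_ge0.
apply: filterS kk'2 => w kw.
have mk'w : measurable_fun setT (fun z => k' (z, w)).
  exact: measurableT_comp mk' (measurable_pair2 w).
have HE z : H (z, w) = g w * ((k' (z, w))%:E * (\1_A z)%:E).
  by rewrite /H /= muleA muleC; congr (_ * _); rewrite muleC.
under eq_integral do rewrite HE.
have mAk : measurable_fun setT (fun z => (k' (z, w))%:E * (\1_A z)%:E).
  by apply: emeasurable_funM; apply/measurable_EFinP.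
have Ak0 z : 0 <= (k' (z, w))%:E * (\1_A z)%:E.
  by rewrite mule_ge0 ?lee_fin.
rewrite ge0_integralZl// lee_wpmul2l//.
apply: ereal_sup_ge; exists (\int[nu]_(z in Omega) (k (z, w))%:E).
  by exists w.
rewrite [leRHS]integral_mkcond; apply: ae_ge0_le_lower_integral => //.
  by move=> z; apply: erestrict_ge0 => // ? _; rewrite lee_fin.
apply: filterS2 kw OA => z <- <-; rewrite epatch_indic.
by rewrite muleC.
Qed.

End schur.

(** * Bochner integrals and seminorms *)

Definition extended_seminorm (R : realType) (V : lmodType R[i])
    (N : V -> \bar R) :=
  [/\ forall v, (0 <= N v)%E,
      forall u v, (N (u + v)%R <= N u + N v)%E &
      forall (r : R) v, N (r%:C *: v) = (`|r|%:E * N v)%E].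

Section extended_seminorm_theory.
Local Open Scope ereal_scope.
Context (R : realType) (V : lmodType R[i]) (N : V -> \bar R).
Hypothesis HN : extended_seminorm N.

Lemma eseminorm_ge0 v : 0 <= N v. Proof. by have [+ _ _] := HN. Qed.

Lemma eseminormD u v : N (u + v)%R <= N u + N v.
Proof. by have [_ + _] := HN. Qed.

Lemma eseminormZ (r : R) v : N (r%:C *: v)%R = `|r|%:E * N v.
Proof. by have [_ _] := HN. Qed.

Lemma eseminorm0 : N 0%R = 0.
Proof. by rewrite -(scale0r (0 : V)) eseminormZ normr0 mul0e. Qed.

Lemma eseminormN v : N (- v)%R = N v.
Proof.
rewrite -scaleN1r (_ : -1 = (-1)%:C)%R; last by rewrite rmorphN rmorph1.
by rewrite eseminormZ normrN1 mul1e.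
Qed.

Lemma eseminormB u v : N (u - v)%R = N (v - u)%R.
Proof. by rewrite -opprB eseminormN. Qed.

Lemma eseminorm_le u v : N u <= N (u - v)%R + N v.
Proof. by apply: le_trans (eseminormD _ _); rewrite subrK. Qed.

Lemma eseminorm_cvg (s : nat -> V) v :
  N (v - s n)%R @[n --> \oo] --> 0 -> N (s n) @[n --> \oo] --> N v.
Proof.
move=> sv.
have lower : N v - N (v - s n)%R @[n --> \oo] --> N v.
  rewrite -[X in _ --> X]sube0; apply: cvgeB => //; last exact: cvg_cst.
  by rewrite fin_num_adde_defl.
have upper : N (v - s n)%R + N v @[n --> \oo] --> N v.
  rewrite -[X in _ --> X]add0e; apply: cvgeD => //; exact: cvg_cst.
apply: squeeze_cvge lower upper; near=> n.
have dfin : N (v - s n)%R \is a fin_num by near: n; have /fine_cvgP[] := sv.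
rewrite leeBlDl//; apply/andP; split; first exact: eseminorm_le.
by rewrite eseminormB; exact: eseminorm_le.
Unshelve. all: by end_near. Qed.

Lemma eseminorm_sum (I : choiceType) (A : set I) (F : I -> V) :
  finite_set A -> N (\sum_(i \in A) F i)%R <= \sum_(i \in A) N (F i).
Proof.
move=> finA; rewrite !fsbig_finite//=.
elim/big_rec2 : _ => [|i x y _ xy]; first by rewrite eseminorm0.
by apply: le_trans (eseminormD _ _) _; rewrite leeD2l.
Qed.

End extended_seminorm_theory.

Section bochner.
Local Open Scope ereal_scope.
Context d (Z : measurableType d) (R : realType).
Variable nu : {measure set Z -> \bar R}.
Variables (V : lmodType R[i]) (S : set V) (N : V -> \bar R).
Hypothesis HN : extended_seminorm N.
Implicit Types (s F : Z -> V) (v : V).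

(** The seminorm of a simple function takes finitely many values, each on a
    measurable set, so its composition with any [N] is measurable. *)
Lemma measurable_eseminorm_simple s : simple_function nu S s ->
  measurable_fun setT (N \o s).
Proof.
move=> [fs ms _ _] _ B mB; rewrite setTI.
rewrite (_ : _ @^-1` B =
  \bigcup_(v in range s `&` [set v | B (N v)]) s @^-1` [set v]).
  apply: fin_bigcup_measurable => [|v _]; last exact: ms.
  exact: finite_setIl.
apply/seteqP; split=> [z Bz|z [v [_ Bv] /= szv]]; last by rewrite /= szv.
by exists (s z) => //; split => //; exists z.
Qed.

Lemma eseminorm_simple_integral s : simple_function nu S s ->
  N (simple_integral nu s) <= \int[nu]_z N (s z).
Proof.
move=> ss; have [fs ms oos _] := ss.
apply: le_trans (eseminorm_sum HN _ fs) _.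
have -> : \int[nu]_z N (s z) =
    \int[nu]_z \sum_(v \in range s) N v * (\1_(s @^-1` [set v]) z)%:E.
  apply: eq_integral => z _.
  rewrite (fsbigD1 (s z))//=; last by exists z.
  rewrite indicE mem_set// mule1 fsbig1 ?adde0// => v [_ /= vsz].
  by rewrite indicE memNset ?mule0//= => szv; exact/vsz/esym.
rewrite ge0_integral_fsum//; last 2 first.
- move=> v; apply: measurable_funeM; apply/measurable_EFinP.
  exact: measurable_indic.
- by move=> v z _; rewrite mule_ge0 ?(eseminorm_ge0 HN)// lee_fin.
apply: lee_fsum => // v _.
rewrite ge0_integralZl ?(eseminorm_ge0 HN)//; last first.
  by apply/measurable_EFinP; exact: measurable_indic.
rewrite integral_indic// setIT (eseminormZ HN) muleC.
have [->|v0] := eqVneq v 0%R; first by rewrite (eseminorm0 HN) !mul0e.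
rewrite lee_wpmul2l ?(eseminorm_ge0 HN)// ger0_norm ?fine_ge0//.
by rewrite fineK// ge0_fin_numE// oos.
Qed.

(** By the triangle inequality, the seminorms of the approximating simple
    functions converge to [N \o F] almost everywhere. *)
Lemma completion_measurable_eseminorm F : strongly_measurable nu S N F ->
  completion_measurable_fun nu (N \o F).
Proof.
move=> [_ [s ss sF]].
exists (fun z => limn_esup (fun n => N (s n z))).
  apply: measurable_fun_limn_esup => n.
  exact: measurable_eseminorm_simple.
apply: filterS sF => z sF _ /=.
have sv := eseminorm_cvg HN sF.
by rewrite is_cvg_limn_esupE ?(cvg_lim _ sv)//; apply/cvg_ex; exists (N (F z)).
Qed.

(** For the approximating simple functions [s n], [N v] is at most
    [N (v - I n) + N (I n)] with [I n] the integral of [s n], and [N (I n)] is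
    at most the integral of [N (s n)], hence at most the sum of the integrals of
    [N (F - s n)] and [N F]; the terms other than the last tend to [0]. *)
Lemma eseminorm_bochner_integral F v : is_bochner_integral nu S N F v ->
  N v <= \int[nu]_z N (F z).
Proof.
move=> [_ mF [s [ss sF sv]]].
have [q mq Fq] := completion_measurable_eseminorm mF.
have N0 z : 0 <= N (F z) by exact: eseminorm_ge0.
have qE : \int[nu]_z N (F z) = \int[nu]_z `|q z|.
  apply: ae_eq_lower_integral => //.
  by apply: filterS Fq => z /(_ I) /= <-; rewrite gee0_abs.
have [Joo|Joo] := eqVneq (\int[nu]_z N (F z)) +oo; first by rewrite Joo leey.
have Jfin : \int[nu]_z N (F z) \is a fin_num.
  by rewrite ge0_fin_numE ?lt_neqAle ?Joo ?leey//; exact: integral_ge0.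
have bound n : N v <= N (v - simple_integral nu (s n))%R +
    (\int[nu]_z N (F z - s n z)%R + \int[nu]_z N (F z)).
  apply: le_trans (eseminorm_le HN v (simple_integral nu (s n))) _.
  apply: leeD => //; apply: le_trans (eseminorm_simple_integral (ss n)) _.
  rewrite qE; apply: le_lower_integralD => //.
  - exact: measurable_eseminorm_simple.
  - exact: measurableT_comp.
  - by move=> z; exact: eseminorm_ge0.
  - by move=> z; exact: eseminorm_ge0.
  - apply: filterS Fq => z /(_ I) /= <-; rewrite gee0_abs//.
    by rewrite eseminormB//; exact: eseminorm_le.
have /(cvgeD _ sv) : \int[nu]_z N (F z - s n z)%R + \int[nu]_z N (F z)
    @[n --> \oo] --> 0 + \int[nu]_z N (F z).
  by apply: cvgeD => //; exact: cvg_cst.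
rewrite !add0e => /(_ isT) lim.
rewrite -(cvg_lim _ lim)//; apply: lime_ge.
  by apply/cvg_ex; eexists; exact: lim.
exact: nearW.
Qed.

End bochner.

(** * The L2 norm, the operator norm and the Hilbert-Schmidt norm *)

(** With [t = sqrt z / sqrt y] the hypothesis reads
    [x <= (sqrt y + sqrt z) ^ 2].  To avoid dividing by zero, both roots are
    first enlarged by [e / 2]. *)
Lemma sqrte_leD (R : realType) (x y z : \bar R) :
  (0 <= x -> 0 <= y -> 0 <= z ->
   (forall t : R, (0 < t)%R -> x <= (1 + t)%:E * y + (1 + t^-1)%:E * z) ->
   sqrte x <= sqrte y + sqrte z)%E.
Proof.
case: y => [y| |] //; last first.
  by rewrite /= addye ?leey// gt_eqF// (lt_le_trans ltNy0)// sqrte_ge0.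
case: z => [z| |] //; last by rewrite /= addey ?leey.
case: x => [x| |] // x0 y0 z0 h; last first.
  by have := h _ ltr01; rewrite -!EFinM -EFinD leye_eq.
rewrite /= -EFinD lee_fin; apply/ler_addgt0Pr => e e0.
rewrite lee_fin in x0; rewrite lee_fin in y0; rewrite lee_fin in z0.
set a := Num.sqrt y; set b := Num.sqrt z.
have a0 : 0 <= a by exact: sqrtr_ge0.
have b0 : 0 <= b by exact: sqrtr_ge0.
have yE : y = a ^+ 2 by rewrite sqr_sqrtr.
have zE : z = b ^+ 2 by rewrite sqr_sqrtr.
pose p := a + e / 2; pose q := b + e / 2.
have p0 : 0 < p by rewrite ltr_wpDl// divr_gt0.
have q0 : 0 < q by rewrite ltr_wpDl// divr_gt0.
have ap : a ^+ 2 <= p ^+ 2.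
  by rewrite ler_sqr ?nnegrE ?(ltW p0)// lerDl divr_ge0 ?ltW.
have bq : b ^+ 2 <= q ^+ 2.
  by rewrite ler_sqr ?nnegrE ?(ltW q0)// lerDl divr_ge0 ?ltW.
rewrite (_ : a + b + e = p + q); last by rewrite /p /q; field.
have pq0 : 0 <= p + q by rewrite addr_ge0// ltW.
rewrite -(ger0_norm pq0) -sqrtr_sqr ler_sqrt ?sqr_ge0//.
have := h (q / p); rewrite divr_gt0// => /(_ isT).
rewrite -!EFinM -EFinD lee_fin => /le_trans; apply.
rewrite yE zE invf_div.
have -> : (p + q) ^+ 2 = (1 + q / p) * p ^+ 2 + (1 + p / q) * q ^+ 2.
  by field; rewrite !gt_eqF.
by rewrite lerD// ler_wpM2l// addr_ge0// divr_ge0// ltW.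
Qed.

Section L2_norm.
Context d (T : measurableType d) (R : realType).
Variable mu : {measure set T -> \bar R}.
Local Notation H := (L2 mu).
Implicit Types u v : H.

Lemma L2val_pi (f : L2fun mu) : L2val (\pi_H%qT f) = val f %[ae mu].
Proof.
have : repr (\pi_H%qT f) - f \in @ae_zero _ _ _ mu.
  by rewrite Quotient.idealrBE reprK.
rewrite inE /= => h; apply: filterS h => x /(_ I) /= h _.
have : sval (repr (\pi_H%qT f)) x - sval f x = 0 by [].
by move/eqP; rewrite subr_eq0 => /eqP.
Qed.

Lemma L2valD u v : L2val (u + v) = (fun x => L2val u x + L2val v x) %[ae mu].
Proof.
have -> : u + v = \pi_H%qT (repr u + repr v : L2fun mu).
  by rewrite -[in LHS](reprK u) -[in LHS](reprK v); exact/esym/Quotient.pi_add.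
exact: L2val_pi.
Qed.

Lemma L2valZ (a : R[i]) u : L2val (a *: u) = (fun x => a * L2val u x) %[ae mu].
Proof. exact: (L2val_pi (a *: (repr u : L2fun mu))). Qed.

Lemma L2val_square_integrable u :
  [/\ measurable_fun setT (fun x => complex.Re (L2val u x)),
      measurable_fun setT (fun x => complex.Im (L2val u x)) &
      (\int[mu]_x (abs2 (L2val u x))%:E < +oo)%E].
Proof. by have := valP (repr u : L2fun mu); rewrite inE. Qed.

Lemma measurable_abs2_L2val u :
  measurable_fun setT (fun x => (abs2 (L2val u x))%:E).
Proof.
have [mr mi _] := L2val_square_integrable u.
by apply/measurable_EFinP; exact: measurable_abs2.
Qed.

Lemma sqr_L2norm u :
  ((L2norm u ^+ 2)%:E = \int[mu]_x (abs2 (L2val u x))%:E)%E.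
Proof.
have [_ _ fin] := L2val_square_integrable u.
have E : complex.Re (inner u u) = \int[mu]_x abs2 (L2val u x).
  rewrite /inner /=; apply: eq_Rintegral => x _.
  by case: (L2val u x) => p q; rewrite /abs2 /= mulrN opprK -!expr2.
rewrite /L2norm sqr_sqrtr E; last first.
  by apply: Rintegral_ge0 => x _; exact: abs2_ge0.
rewrite /Rintegral fineK// ge0_fin_numE//.
by apply: integral_ge0 => x _; rewrite lee_fin abs2_ge0.
Qed.

Lemma L2norm_ge0 u : 0 <= L2norm u. Proof. exact: sqrtr_ge0. Qed.

(** The triangle inequality in the squared form that survives integration,
    summation and suprema; the difference of the two sides is pointwise
    [t^-1 * |t u - v|^2]. *)
Lemma sqr_L2normD u v (t : R) : 0 < t ->
  L2norm (u + v) ^+ 2 <= (1 + t) * L2norm u ^+ 2 + (1 + t^-1) * L2norm v ^+ 2.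
Proof.
move=> t0; rewrite -lee_fin EFinD (EFinM (1 + t)) (EFinM (1 + t^-1)).
rewrite !sqr_L2norm.
have ti0 : 0 < t^-1 by rewrite invr_gt0.
have Q0 w x : (0 <= (abs2 (L2val w x))%:E)%E by rewrite lee_fin abs2_ge0.
have m w := measurable_abs2_L2val w.
rewrite -!ge0_integralZl//; do ?by rewrite lee_fin addr_ge0// ltW.
rewrite -ge0_integralD//; do ?[exact: measurable_funeM |
  by move=> x _; rewrite mule_ge0// lee_fin addr_ge0// ltW].
apply: ae_ge0_le_lower_integral => //.
  by move=> x; rewrite adde_ge0// mule_ge0// lee_fin addr_ge0// ltW.
apply: filterS (L2valD u v) => x /(_ I) ->.
rewrite -!EFinM -EFinD lee_fin.
case: (L2val u x) (L2val v x) => [a b] [p q]; rewrite /abs2 /=.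
rewrite -subr_ge0 (_ : _ - _ = t^-1 * ((t * a - p) ^+ 2 + (t * b - q) ^+ 2)).
  by rewrite mulr_ge0 ?(ltW ti0)// addr_ge0// sqr_ge0.
by field; rewrite gt_eqF.
Qed.

Lemma L2normZ (r : R) u : L2norm (r%:C *: u) = `|r| * L2norm u.
Proof.
apply/eqP; rewrite -(@eqrXn2 _ 2) ?L2norm_ge0 ?mulr_ge0 ?L2norm_ge0//.
rewrite exprMn real_normK ?num_real//; apply/eqP/EFin_inj.
have Q0 w x : (0 <= (abs2 (L2val w x))%:E)%E by rewrite lee_fin abs2_ge0.
rewrite [in RHS]EFinM !sqr_L2norm -ge0_integralZl//; last 2 first.
- exact: measurable_abs2_L2val.
- by rewrite lee_fin sqr_ge0.
apply: ae_eq_lower_integral => //.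
  by move=> x; rewrite mule_ge0// lee_fin sqr_ge0.
apply: filterS (L2valZ r%:C u) => x /(_ I) ->.
case: (L2val u x) => a b; rewrite /abs2 /= -EFinM; congr EFin.
by ring.
Qed.

Lemma L2norm0 : L2norm (0 : H) = 0.
Proof. by rewrite -(scale0r (0 : H)) L2normZ normr0 mul0r. Qed.

Lemma bounded_op0 (A : H -> H) : bounded_op A -> A 0 = 0.
Proof.
move=> [linA _]; have := linA (-1) 0 0.
by rewrite scaler0 add0r scaleN1r addNr.
Qed.

(** Either [adjoint A] is a bounded operator or it is the default value [0]. *)
Lemma adjoint0 (A : H -> H) : adjoint A 0 = 0.
Proof.
rewrite /adjoint; set P := [set _ | _].
have [[B PB]|nP] := pselect (exists B, P B).
  by have [/bounded_op0] := xgetPex 0 (ex_intro _ B PB).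
by rewrite xgetPN// => B PB; apply: nP; exists B.
Qed.

Lemma op_norm_ge0 (A : H -> H) : (0 <= op_norm A)%E.
Proof.
apply: (@le_trans _ _ (L2norm (A 0))%:E); first by rewrite lee_fin L2norm_ge0.
by apply: ereal_sup_ubound; exists 0 => //=; rewrite L2norm0.
Qed.

Lemma op_norm_fin_num (A : H -> H) : bounded_op A -> op_norm A \is a fin_num.
Proof.
move=> [_ [C AC]]; rewrite ge0_fin_numE ?op_norm_ge0//.
apply: (@le_lt_trans _ _ `|C|%:E); last exact: ltry.
apply: ge_ereal_sup => _ [u /= u1 <-]; rewrite lee_fin.
apply: le_trans (AC u) _; apply: le_trans (ler_norm _) _.
by rewrite normrM ler_piMr// ger0_norm// L2norm_ge0.
Qed.

Lemma le_op_norm (A : H -> H) u : bounded_op A ->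
  L2norm (A u) <= fine (op_norm A) * L2norm u.
Proof.
move=> bA; have [linA [C AC]] := bA.
have [u0|u0] := eqVneq (L2norm u) 0.
  by have := AC u; rewrite u0 !mulr0.
have ugt0 : 0 < L2norm u by rewrite lt_neqAle eq_sym u0 L2norm_ge0.
rewrite -ler_pdivrMr// -lee_fin fineK ?op_norm_fin_num//.
apply: ereal_sup_ubound; exists ((L2norm u)^-1%:C *: u) => /=.
  by rewrite L2normZ normfV ger0_norm ?L2norm_ge0// mulVf.
have := linA (L2norm u)^-1%:C u 0; rewrite !addr0 bounded_op0// addr0 => ->.
by rewrite L2normZ normfV ger0_norm ?L2norm_ge0// mulrC.
Qed.

End L2_norm.

Section esum_scale.
Local Open Scope ereal_scope.

Lemma esumZ_le (R : realType) (I : choiceType) (E : set I) (c : R)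
    (a : I -> \bar R) :
  (0 <= c)%R -> (forall i, 0 <= a i) ->
  \esum_(i in E) (c%:E * a i) <= c%:E * \esum_(i in E) a i.
Proof.
move=> c0 a0; apply: ge_ereal_sup => _ [F FE <-].
rewrite -ge0_mule_fsumr//; apply: lee_wpmul2l; first by rewrite lee_fin.
by apply: ereal_sup_ubound; exists F.
Qed.

End esum_scale.

Section hs_norm.
Local Open Scope ereal_scope.
Context d (T : measurableType d) (R : realType).
Variable mu : {measure set T -> \bar R}.
Local Notation H := (L2 mu).
Hypothesis basis0 : @orthonormal_basis _ _ _ mu !=set0.
Implicit Types A B : H -> H.

Let hs_sqr A := ereal_sup [set \esum_(e in E) (L2norm (A e) ^+ 2)%:E
                          | E in @orthonormal_basis _ _ _ mu].

Let hs_sqr_ge0 A : 0 <= hs_sqr A.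
Proof.
have [E EE] := basis0; apply: le_trans (ereal_sup_ubound _); last by exists E.
by apply: esum_ge0 => e _; rewrite lee_fin sqr_ge0.
Qed.

Let esum_hs_sqr E A : @orthonormal_basis _ _ _ mu E ->
  \esum_(e in E) (L2norm (A e) ^+ 2)%:E <= hs_sqr A.
Proof. by move=> EE; apply: ereal_sup_ubound; exists E. Qed.

(** The common source of homogeneity and of the ideal property: a pointwise
    comparison of norms carries over term by term in every basis. *)
Lemma hs_norm_le A B (c : R) : (0 <= c)%R ->
  (forall u, (L2norm (A u) <= c * L2norm (B u))%R) ->
  hs_norm A <= c%:E * hs_norm B.
Proof.
move=> c0 AB.
have -> : c%:E = sqrte (c ^+ 2)%:E by rewrite /= sqrtr_sqr ger0_norm.
rewrite /hs_norm -/(hs_sqr A) -/(hs_sqr B) -sqrteM ?lee_fin ?sqr_ge0//.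
rewrite lee_sqrt; last by rewrite mule_ge0// lee_fin sqr_ge0.
apply: ge_ereal_sup => _ [E EE <-].
apply: (@le_trans _ _ (\esum_(e in E) ((c ^+ 2)%:E * (L2norm (B e) ^+ 2)%:E))).
  apply: le_esum => e _; rewrite -EFinM lee_fin -exprMn.
  by rewrite ler_sqr ?nnegrE ?mulr_ge0 ?L2norm_ge0.
apply: le_trans (esumZ_le _ _ _) _; rewrite ?sqr_ge0//.
  by move=> e; rewrite lee_fin sqr_ge0.
by apply: lee_wpmul2l; [rewrite lee_fin sqr_ge0|exact: esum_hs_sqr].
Qed.

Lemma hs_norm_ge0 A : 0 <= hs_norm A. Proof. exact: sqrte_ge0. Qed.

Lemma hs_norm_comp A B : bounded_op A ->
  hs_norm (A \o B) <= op_norm A * hs_norm B.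
Proof.
move=> bA; rewrite -(fineK (op_norm_fin_num bA)); apply: hs_norm_le.
  by rewrite fine_ge0// op_norm_ge0.
by move=> u /=; exact: le_op_norm.
Qed.

Lemma hs_normD A B : hs_norm (A + B)%R <= hs_norm A + hs_norm B.
Proof.
apply: sqrte_leD; [exact: hs_sqr_ge0 ..|] => t t0.
have ti0 : (0 < t^-1)%R by rewrite invr_gt0.
have t1 : (0 <= 1 + t)%R by rewrite addr_ge0 ?ltW.
have t2 : (0 <= 1 + t^-1)%R by rewrite addr_ge0 ?ltW.
apply: ge_ereal_sup => _ [E EE <-].
pose a e := (1 + t)%:E * (L2norm (A e) ^+ 2)%:E.
pose b e := (1 + t^-1)%:E * (L2norm (B e) ^+ 2)%:E.
have sq0 (C : H -> H) e : 0 <= (L2norm (C e) ^+ 2)%:E.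
  by rewrite lee_fin sqr_ge0.
apply: (@le_trans _ _ (\esum_(e in E) (a e + b e))).
  apply: le_esum => e _; rewrite /a /b -!EFinM -EFinD lee_fin.
  exact: sqr_L2normD.
rewrite esumD; do ?by move=> e _; rewrite mule_ge0// lee_fin.
apply: leeD; (apply: le_trans (esumZ_le _ _ _) _; [by []|exact: sq0|];
  by apply: lee_wpmul2l; [rewrite lee_fin|exact: esum_hs_sqr]).
Qed.

Lemma hs_normZ_le (r : R) A : hs_norm (r%:C *: A)%R <= `|r|%:E * hs_norm A.
Proof. by apply: hs_norm_le => // u; rewrite L2normZ. Qed.

Lemma extended_seminorm_hs_norm : extended_seminorm (@hs_norm _ _ _ mu).
Proof.
split; [exact: hs_norm_ge0|exact: hs_normD|move=> r A].
apply/eqP; rewrite eq_le hs_normZ_le /=.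
have [->|r0] := eqVneq r 0%R; first by rewrite normr0 mul0e hs_norm_ge0.
have rgt0 : (0 < `|r|)%R by rewrite normr_gt0.
rewrite muleC -lee_pdivlMr//.
have {1}-> : A = (r^-1%:C *: (r%:C *: A))%R.
  by rewrite scalerA -rmorphM mulVf// rmorph1 scale1r.
by rewrite muleC -normfV; exact: hs_normZ_le.
Qed.

End hs_norm.

(** * Kernel operators on operator-valued functions *)

(** The degenerate cases give [c / f = 0]: if [f = 0] then [c = 0] and
    [0 * 0^-1 = 0 * +oo = 0]; if [f = +oo] then [f^-1 = 0]. *)
Lemma ediv_le_mul (R : realType) (c f theta S : \bar R) :
  (0 <= c -> c <= f -> 0 <= theta -> 0 <= S ->
   (0 < f -> f \is a fin_num ->
    exists g, [/\ 0 <= g, c <= S * g & g / f <= theta]) ->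
   c / f <= theta * S)%E.
Proof.
move=> c0 cf theta0 S0 fg.
have f0 : (0 <= f)%E by exact: le_trans cf.
have [foo|fltoo] := eqVneq f +oo%E; first by rewrite foo invey mule0 mule_ge0.
have [fE0|fneq0] := eqVneq f 0%E.
  have -> : c = 0%E by apply/eqP; rewrite eq_le c0 -fE0 cf.
  by rewrite mul0e mule_ge0.
have fgt0 : (0 < f)%E by rewrite lt_neqAle eq_sym fneq0.
have ffin : f \is a fin_num by rewrite ge0_fin_numE// lt_neqAle fltoo leey.
have [g [g0 cSg gf]] := fg fgt0 ffin.
apply: le_trans (lee_wpmul2r _ cSg) _; first by rewrite inve_ge0.
by rewrite -muleA muleC; exact: lee_wpmul2r.
Qed.

Section kernel_operator.
Local Open Scope ereal_scope.
Context (R : realType) (d : nat).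
Local Notation H := (L2 (leb R d)).
Local Notation phase := (d.-tuple R * d.-tuple R)%type.
Implicit Types (F G : phase -> H -> H) (K : phase -> phase -> H -> H).
Hypothesis basis0 : @orthonormal_basis _ _ _ (leb R d) !=set0.

Lemma L1S2norm_ge0 F : 0 <= L1S2norm F.
Proof. by apply: integral_ge0 => z _; exact: hs_norm_ge0. Qed.

Lemma ae_eq_L1S2norm F G : F = G %[ae leb2 R d] -> L1S2norm F = L1S2norm G.
Proof.
move=> FG; apply: ae_eq_lower_integral.
- by move=> z; exact: hs_norm_ge0.
- by move=> z; exact: hs_norm_ge0.
- by apply: filterS FG => z /(_ I) ->.
Qed.

Lemma hs_norm_kernel_op K G z : integrable_kernel_at K G z ->
  hs_norm (kernel_op K G z) <=
  \int[leb2 R d]_w hs_norm (K z w \o G w).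
Proof.
move=> intK; have hsE := extended_seminorm_hs_norm basis0.
exact: (eseminorm_bochner_integral hsE (xgetPex 0%R intK)).
Qed.

(** The Schur bound for [u z = N (I_K G z)], [n z w = N (K z w o G w)] and
    [f w = N (G w)]. *)
Lemma L1S2norm_cut_kernel_op K G (Omega : set phase) :
  completed_algebra_gen (leb2 R d) Omega ->
  (forall z w, bounded_op (K z w)) ->
  completion_measurable_fun (leb4 R d) (fun p => op_norm (K p.1 p.2)) ->
  {ae leb2 R d, forall z, integrable_kernel_at K G z} ->
  L1S2norm G < +oo ->
  \int[leb2 R d]_z ((\1_Omega z)%:E * hs_norm (kernel_op K G z)) <=
  ereal_sup (range (fun w => \int[leb2 R d]_(z in Omega) op_norm (K z w))) *
  L1S2norm G.
Proof.
move=> mOmega bK mK intK Goo.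
have hsE := extended_seminorm_hs_norm basis0.
pose k (p : phase * phase) := fine (op_norm (K p.1 p.2)).
have kE p : (k p)%:E = op_norm (K p.1 p.2) by rewrite fineK// op_norm_fin_num.
under [X in range X]eq_fun do under eq_integral do rewrite -(kE (_, _)).
apply: (@schur_bound _ _ _ (leb2 R d) (leb4 R d) k _ _
  (fun z w => hs_norm (K z w \o G w))) => //.
- by move=> p; rewrite fine_ge0// op_norm_ge0.
- by rewrite (_ : _ \o _ = fun p => op_norm (K p.1 p.2))//; exact/funext.
- by move=> w; exact: hs_norm_ge0.
- by move=> w; exact: hs_norm_ge0.
apply: filterS intK => z intK; split.
- have [v [_ smKG _]] := intK.
  exact: (completion_measurable_eseminorm hsE smKG).
- by move=> w; rewrite hs_norm_ge0 kE; exact: hs_norm_comp.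
- exact: hs_norm_kernel_op.
Qed.

End kernel_operator.

Theorem proposition4p1 (R : realType) (d : nat)
    (gamma rho : L2 (leb R d) -> L2 (leb R d))
    (Omega : set (d.-tuple R * d.-tuple R))
    (K : d.-tuple R * d.-tuple R -> d.-tuple R * d.-tuple R ->
         L2 (leb R d) -> L2 (leb R d)) :
  M1 R d gamma -> M1 R d rho -> hs_norm gamma = 1%E -> rho <> 0 ->
  completed_algebra_gen (leb2 R d) Omega ->
  (forall z w, bounded_op (K z w)) ->
  completion_measurable_fun (leb4 R d) (fun p => op_norm (K p.1 p.2)) ->
  (forall F, (stft gamma @` M1 R d) F ->
     {ae leb2 R d, forall z, integrable_kernel_at K F z}) ->
  boundedly_invertible_on (leb2 R d) (@hs_norm _ _ _ (leb R d))
    (stft gamma @` M1 R d) (kernel_op K) ->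
  (L1S2norm (fun z => (\1_Omega z)%:C *: stft gamma rho z) /
     L1S2norm (stft gamma rho) <=
   theta gamma K *
     ereal_sup (range (fun w => \int[leb2 R d]_(z in Omega) op_norm (K z w))))%E.

Proof.
move=> Mgamma Mrho gamma1 rho0 mOmega bK mK intK [_ _ onto [B IB] [C IC]].
set F := stft gamma rho.
set S := ereal_sup (_ @` _).
(* A Hilbert-Schmidt norm equal to 1 is a supremum over a nonempty set. *)
have basis0 : @orthonormal_basis _ _ _ (leb R d) !=set0.
  apply: contrapT => noE; move: gamma1.
  rewrite /hs_norm (_ : [set _ | _ in _] = set0).
    by rewrite ereal_sup0 /= => /eqP; rewrite eqe eq_sym oner_eq0.
  by apply/seteqP; split => // x [E EE]; case: noE; exists E.
have hsE := extended_seminorm_hs_norm basis0.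
have S0 : (0 <= S)%E.
  apply: ereal_sup_ge; eexists; first by exists point.
  by apply: integral_ge0 => z _; exact: op_norm_ge0.
have theta0 : (0 <= theta gamma K)%E.
  apply: ereal_sup_ge; eexists; first by exists rho => //; split.
  by rewrite mule_ge0// ?inve_ge0 L1S2norm_ge0.
have cutE : L1S2norm (fun z => (\1_Omega z)%:C *: F z) =
    (\int[leb2 R d]_z ((\1_Omega z)%:E * hs_norm (F z)))%E.
  apply: eq_integral => z _.
  have Omega0 : 0 <= \1_Omega z :> R by rewrite indicE.
  by rewrite -[in RHS](ger0_norm Omega0); exact: (eseminormZ hsE).
have cut_le : (L1S2norm (fun z => (\1_Omega z)%:C *: F z) <= L1S2norm F)%E.
  rewrite cutE; apply: ge0_le_lower_integral => z.
    by rewrite mule_ge0 ?hs_norm_ge0// lee_fin.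
  by rewrite gee_pMl ?hs_norm_ge0// lee_fin indicE; case: (_ \in _).
apply: ediv_le_mul cut_le theta0 S0 _; first exact: L1S2norm_ge0.
move=> Fgt0 Ffin.
have [G XG IG] : exists2 G, (stft gamma @` M1 R d) G &
    kernel_op K G = F %[ae leb2 R d] by apply: onto; exists rho.
have IGF := ae_eq_L1S2norm IG.
have IGB : (L1S2norm F <= B%:E * L1S2norm G)%E by rewrite -IGF; exact: IB.
have GIC : (L1S2norm G <= C%:E * L1S2norm F)%E by rewrite -IGF; exact: IC.
exists (L1S2norm G); split.
- exact: L1S2norm_ge0.
- have Goo : (L1S2norm G < +oo)%E.
    apply: le_lt_trans GIC _.
    by rewrite -(fineK Ffin) -EFinM; exact: ltry.
  have := L1S2norm_cut_kernel_op basis0 mOmega bK mK (intK G XG) Goo.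
  apply: le_trans; rewrite cutE; apply: ae_ge0_le_lower_integral.
  + by move=> z; rewrite mule_ge0 ?hs_norm_ge0// lee_fin.
  + by move=> z; rewrite mule_ge0 ?hs_norm_ge0// lee_fin.
  + by apply: filterS IG => z /(_ I) ->.
- have [sigma Msigma sigmaG] := XG.
  apply: ereal_sup_ubound; exists sigma; last by rewrite sigmaG IGF.
  split; first exact: Msigma.
  move=> sigma0; have G0 : L1S2norm G = 0%E.
    rewrite -sigmaG sigma0; apply: integral0_eq => z _.
    rewrite (_ : stft gamma 0 z = 0); first exact: (eseminorm0 hsE).
    by apply/funext => u; rewrite /stft /= !adjoint0.
  by move: IGB Fgt0; rewrite G0 mule0 leNgt => /negP.
Qed.
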